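(* Let $k\ge r\ge0$ be integers. For every $m\in\{0,\dots,k-r\}$, the map $\Psi_{kr}$ induces an isomorphism $U_{krm}\cong V_{krm}$; that is, $\Psi_{kr}$ restricts to a linear bijection from $U_{krm}$ onto $V_{krm}$.
   Context: Let $V_{kr}$ be the real vector space with basis the words $e\in\{\mathbf 1,\mathbf 2\}^k$ having exactly $k-r$ letters $\mathbf 1$ and $r$ letters $\mathbf 2$, with the inner product making these words orthonormal. The deletion operator $\partial:V_{kr}\to V_{(k-1)r}$ (with $V_{kr}=\{0\}$ if $k<r$) sends a word $e$ to the sum, over all positions of $e$ carrying $\mathbf 1$, of the word obtained by deleting that letter. For $m\in\{0,\dots,k-r\}$, $$V_{krm}=\left(\ker\partial^{\,k-r-m+1}\right)\cap\left(\ker\partial^{\,k-r-m}\right)^{\perp}\subseteq V_{kr}.$$ Discrete simplex: $\Delta_{kr}=\{(d_0,\dots,d_r)\in\mathbb Z^{r+1}: d_0,\dots,d_r\ge0,\ d_0+\dots+d_r=k-r\}$. For $P,Q\in\mathbb R[x_0,\dots,x_r]$ let $\langle P,Q\rangle_{kr}=\sum_{\mathbf d\in\Delta_{kr}}P(\mathbf d)Q(\mathbf d)$. Let $\mathbb R_m[x_1,\dots,x_r]$ be the space of polynomials of total degree at most $m$ in $x_1,\dots,x_r$ (not involving $x_0$). Recursively define $$U_{krm}=\left\{P\in\mathbb R_m[x_1,\dots,x_r]:\ \langle P,Q\rangle_{kr}=0\ \text{ for all } Q\in U_{kr0}\cup\dots\cup U_{kr(m-1)}\right\}.$$ The linear map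 $\Psi_{kr}:\mathbb R[x_0,\dots,x_r]\to V_{kr}$ is $$\Psi_{kr}(P)=\sum_{\mathbf d\in\Delta_{kr}}P(\mathbf d)\;\mathbf 1^{d_0}\,\mathbf 2\,\mathbf 1^{d_1}\,\mathbf 2\,\mathbf 1^{d_2}\cdots\mathbf 2\,\mathbf 1^{d_r}.$$ *)

(* Defs.v *)
From HB Require Import structures.
From mathcomp Require Import all_boot all_order all_algebra.
From mathcomp Require Import mpoly.
From mathcomp Require Import classical_sets functions reals.

Set Implicit Arguments.
Unset Strict Implicit.
Unset Printing Implicit Defensive.

Import Order.TTheory GRing.Theory Num.Theory.
Local Open Scope ring_scope.

(* The letters 1 and 2 are encoded by false and true. *)
Notation L1 := false (only parsing).
Notation L2 := true (only parsing).

Definition is_word (k r : nat) (s : seq bool) : bool :=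
  (count_mem L1 s == k - r)%N && (count_mem L2 s == r).

(* For k < r this type is empty, since the two counts must add up to k. *)
Definition word (k r : nat) := {w : k.-tuple bool | is_word k r w}.
HB.instance Definition _ k r := Finite.on (word k r).

Definition rawword k r (w : word k r) : seq bool := tval (val w).

Notation Vspace R k r := {ffun word k r -> R^o}.

(* The basis vector attached to a letter sequence; it is 0 when s does not
   belong to word k r, but del_word and simplex_word_word below show that this
   default is never used. *)
Definition wvec (R : realType) (k r : nat) (s : seq bool) : Vspace R k r :=
  [ffun w => (rawword w == s)%:R].
Arguments wvec R k r s : clear implicits.

Definition dotV (R : realType) (k r : nat) (u v : Vspace R k r) : R :=
  \sum_(w : word k r) u w * v w.

Definition del_letter (i : nat) (s : seq bool) : seq bool :=
  take i s ++ drop i.+1 s.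

Lemma del_word k r (w : word k r) (i : nat) :
  (i < k)%N -> nth L2 (rawword w) i = L1 ->
  exists w' : word k.-1 r, rawword w' = del_letter i (rawword w).
Proof.
rewrite /rawword; case: w => -[s /= /eqP sz] /= /andP[/= /eqP c1 /eqP c2] ik si.
have es : s = take i s ++ L1 :: drop i.+1 s.
  by rewrite -si -drop_nth ?sz// cat_take_drop.
have szd : size (del_letter i s) == k.-1.
  by move: sz; rewrite {1}es !size_cat /= addnS => <-.
have wd : is_word k.-1 r (Tuple szd).
  move: c1 c2; rewrite {1 2}es !count_cat /= add0n addnS => c1 c2.
  by rewrite /is_word /= !count_cat c2 eqxx andbT -predn_sub -c1.
by exists (Sub (Tuple szd) wd).
Qed.

(* The target of the operator is indexed by k.-1; for k = 0, where the index
   k - 1 would be negative and the target 0, the operator is identically 0. *)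
Definition del (R : realType) (k r : nat) (v : Vspace R k r) :
    Vspace R k.-1 r :=
  \sum_(w : word k r)
    v w *: \sum_(i < k | nth L2 (rawword w) i == L1)
             wvec R k.-1 r (del_letter i (rawword w)).

Fixpoint del_iter (R : realType) (k r j : nat) (v : Vspace R k r) :
    Vspace R (iter j predn k) r :=
  match j return Vspace R (iter j predn k) r with
  | 0 => v
  | j'.+1 => del (del_iter j' v)
  end.

Definition ker_del (R : realType) (k r j : nat) : set (Vspace R k r) :=
  [set v | del_iter j v = 0]%classic.
Arguments ker_del R k r j : clear implicits.

Definition orthV (R : realType) (k r : nat) (A : set (Vspace R k r)) :
    set (Vspace R k r) :=
  [set v | forall u, A u -> dotV u v = 0]%classic.

Definition Vkrm (R : realType) (k r m : nat) : set (Vspace R k r) :=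
  (ker_del R k r (k - r - m + 1) `&` orthV (ker_del R k r (k - r - m)))%classic.
Arguments Vkrm R k r m : clear implicits.

(* Each coordinate of a point of the simplex is at most k - r. *)
Definition simplex (k r : nat) : {set {ffun 'I_r.+1 -> 'I_(k - r).+1}} :=
  [set d : {ffun 'I_r.+1 -> 'I_(k - r).+1} | (\sum_i d i == k - r)%N].

Definition evalD (R : realType) (k r : nat) (P : {mpoly R[r.+1]})
    (d : {ffun 'I_r.+1 -> 'I_(k - r).+1}) : R :=
  P.@[fun i => (d i : nat)%:R].

Definition dotP (R : realType) (k r : nat) (P Q : {mpoly R[r.+1]}) : R :=
  \sum_(d in simplex k r) evalD P d * evalD Q d.

(* msize is the total degree plus one, and 0 for the zero polynomial. *)
Definition Rm (R : realType) (r m : nat) : set {mpoly R[r.+1]} :=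
  [set P | (forall e, e \in msupp P -> e ord0 = 0%N) /\
           (msize P <= m.+1)%N]%classic.
Arguments Rm R r m : clear implicits.

(* Ubelow m is the union of U_{k,r,0}, ..., U_{k,r,m-1}. *)
Fixpoint Ubelow (R : realType) (k r m : nat) : set {mpoly R[r.+1]} :=
  match m with
  | 0 => set0
  | m'.+1 =>
      @Ubelow R k r m' `|`
      [set P | Rm R r m' P /\ forall Q, @Ubelow R k r m' Q -> dotP k P Q = 0]
  end%classic.
Arguments Ubelow R k r m : clear implicits.

Definition Ukrm (R : realType) (k r m : nat) : set {mpoly R[r.+1]} :=
  [set P | Rm R r m P /\ forall Q, Ubelow R k r m Q -> dotP k P Q = 0]%classic.
Arguments Ukrm R k r m : clear implicits.

Lemma UbelowP (R : realType) (k r m : nat) (P : {mpoly R[r.+1]}) :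
  Ubelow R k r m P <-> exists2 j, (j < m)%N & Ukrm R k r j P.
Proof.
elim: m => [|m IH] /=; first by split=> // -[].
split=> [[/IH[j jm Uj]|Um]|[j]].
- by exists j => //; exact: ltnW.
- by exists m.
- rewrite ltnS leq_eqVlt => /predU1P[->|jm] Uj; first by right.
  by left; apply/IH; exists j.
Qed.

Definition simplex_word (k r : nat) (d : {ffun 'I_r.+1 -> 'I_(k - r).+1}) :
    seq bool :=
  nseq (d ord0) L1 ++
  flatten [seq L2 :: nseq (d (lift ord0 i)) L1 | i <- enum 'I_r].

Lemma simplex_word_word k r (d : {ffun 'I_r.+1 -> 'I_(k - r).+1}) :
  (r <= k)%N -> d \in simplex k r ->
  exists w : word k r, rawword w = simplex_word d.
Proof.
move=> rk; rewrite inE big_ord_recl => /eqP sd.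
have c1 : count_mem L1 (simplex_word d) = (k - r)%N.
  rewrite -sd count_cat count_nseq mul1n count_flatten sumnE 2!big_map big_enum.
  by congr addn; apply: eq_bigr => i _; rewrite /= add0n count_nseq mul1n.
have c2 : count_mem L2 (simplex_word d) = r.
  rewrite count_cat count_nseq mul0n count_flatten sumnE 2!big_map big_enum.
  under eq_bigr => i _ do rewrite /= count_nseq mul0n addn0.
  by rewrite sum1_card card_ord.
have sz : size (simplex_word d) == k.
  rewrite -(count_predC (pred1 L1)) c1 (@eq_count _ _ (pred1 L2)); last by case.
  by rewrite c2 subnK.
have wd : is_word k r (Tuple sz) by rewrite /is_word /= c1 c2 !eqxx.
by exists (Sub (Tuple sz) wd).
Qed.

Definition Psi (R : realType) (k r : nat) (P : {mpoly R[r.+1]}) :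
    Vspace R k r :=
  \sum_(d in simplex k r) evalD P d *: wvec R k r (simplex_word d).
Arguments Psi R k r P : clear implicits.

(* Main.v *)
(** Write a word of V_kr as its vector d of block lengths, and let f_a be the
vector whose entry at d is the product of the falling factorials of the d_s of
orders a_s.  The deletion operator satisfies
<del v, f_a> = (k - r - |a|) <v, f_a>.  Since the f_a with |a| = j are, up to
nonzero scalars, the basis words of the space with j letters 1, this gives: for
i + j = k - r + 1, the kernel of del^i consists of the v orthogonal to all f_a
with |a| < j.  On the simplex, x_0 can be eliminated, so the f_a with |a| < j
span the image under Psi of the polynomials in x_1, ..., x_r of degree < j.
Hence both U_krm and V_krm are the orthogonal complement of the polynomials of
degree < m inside those of degree <= m, and Psi is an isometry between them; it
is injective because all functions on the simplex are interpolated by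
polynomials of degree <= k - r, a space of dimension the size of the simplex. *)

From HB Require Import structures.
Require Import Defs.
From mathcomp Require Import all_boot all_order all_algebra.
From mathcomp Require Import mpoly.
From mathcomp Require Import classical_sets functions reals.
From mathcomp Require Import ring zify.
Import Order.TTheory GRing.Theory Num.Theory.
Local Open Scope ring_scope.

(** * Block lengths of words and their falling factorials *)

Section Words.
Local Open Scope nat_scope.

(* The product of the falling factorials, of orders given by [a], of the lengths
   of the blocks of 1s in [s], the first block being lengthened by [t]. *)
Fixpoint block_ffact (t : nat) (a : seq nat) (s : seq bool) : nat :=
  match s with
  | [::] => t ^_ head 0 a
  | true :: s' => t ^_ head 0 a * block_ffact 0 (behead a) s'
  | false :: s' => block_ffact t.+1 a s'
  end.

Lemma sum_del_letter_cons (g : seq bool -> nat) c s :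
  \sum_(i < size (c :: s) | nth true (c :: s) i == false) g (del_letter i (c :: s))
  = (c == false) * g s
    + \sum_(i < size s | nth true s i == false) g (c :: del_letter i s).
Proof.
rewrite big_mkcond big_ord_recl [in RHS]big_mkcond /= /del_letter /= drop0.
by congr addn; case: c => /=; rewrite ?mul1n.
Qed.

(* The term in [t.-1] accounts for the deletion of one of the [t] letters 1
   already read, which is what makes the induction on [s] go through. *)
Lemma sum_block_ffact_del t a s : size a = (count_mem true s).+1 ->
  t * block_ffact t.-1 a s
  + \sum_(i < size s | nth true s i == false) block_ffact t a (del_letter i s)
  + sumn a * block_ffact t a s
  = (t + count_mem false s) * block_ffact t a s.
Proof.
(* The identity for a single block: deleting any of its [u] letters 1 gives length [u.-1]. *)
have ffactE u b : u * u.-1 ^_ b + b * u ^_ b = u * u ^_ b.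
  case: (leqP b u) => ub; last by rewrite !ffact_small //; lia.
  rewrite -ffactnS ffactnSr mulnC -mulnDl addnC.
  by rewrite subnKC.
elim: s t a => [|c s IH] t [//|b a].
  case: a => //= _; rewrite big_ord0 !addn0; exact: ffactE.
rewrite (sum_del_letter_cons (block_ffact t (b :: a))).
case: c => /= [[/IH e]|e].
  rewrite mul0n add0n -big_distrr /=.
  have := congr1 (muln (t ^_ b)) (e 0); rewrite mul0n !add0n.
  have := congr1 (muln^~ (block_ffact 0 a s)) (ffactE t b).
  by rewrite /=; nia.
have := IH t.+1 (b :: a) e => /=.
(* For positive [t] the boundary term and the deletion of the letter just read merge into [t.+1]
   equal terms; for [t = 0] the boundary term is zero. *)
case: t => [|t] /=; nia.
Qed.

Lemma block_ffact_nseq t a c s :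
  block_ffact t a (nseq c false ++ s) = block_ffact (t + c) a s.
Proof. by elim: c t => [|c IH] t /=; rewrite ?addn0// IH addSnnS. Qed.

Lemma block_ffact_flatten (I : Type) (f g : I -> nat) (l : seq I) t b :
  block_ffact t (b :: map g l)
    (flatten [seq true :: nseq (f i) false | i <- l])
  = (t ^_ b * \prod_(i <- l) f i ^_ g i)%N.
Proof.
elim: l t b => [|i l IH] t b /=; first by rewrite big_nil muln1.
by rewrite block_ffact_nseq add0n IH big_cons.
Qed.

Lemma block_ffact_simplex {k r} (d : {ffun 'I_r.+1 -> 'I_(k - r).+1})
    (a : 'I_r.+1 -> nat) :
  block_ffact 0 [seq a i | i <- enum 'I_r.+1] (simplex_word d)
  = \prod_i (d i) ^_ (a i).
Proof.
rewrite enum_ordSl /= -map_comp /simplex_word block_ffact_nseq add0n.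
rewrite (block_ffact_flatten _ (fun i => nat_of_ord (d (lift ord0 i)))).
by rewrite big_enum big_ord_recl.
Qed.

Lemma prod_ffact_gt0 (I : finType) (d a : I -> nat) :
  (0 < \prod_i (d i) ^_ (a i))%N -> forall i, (a i <= d i)%N.
Proof.
move=> h i; rewrite -ffact_gt0.
by move: h; rewrite (bigD1 i) //= muln_gt0 => /andP[].
Qed.

Lemma sum_leq_eq (I : finType) (d a : I -> nat) :
  (forall i, (a i <= d i)%N) -> (\sum_i a i = \sum_i d i)%N -> a =1 d.
Proof.
move=> le e i; apply/eqP.
have := @leqif_sum I xpredT (fun i => a i == d i) a d
  (fun i _ => leqif_eq (le i)).
by case=> _; rewrite e eqxx => /esym /forallP /(_ i).
Qed.

Lemma simplex_sum {k r} (d : {ffun 'I_r.+1 -> 'I_(k - r).+1}) :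
  d \in simplex k r -> (\sum_i d i)%N = (k - r)%N.
Proof. by rewrite inE => /eqP. Qed.

(** A nonzero product forces e <= d coordinatewise, and both sum to k - r. Thus the top-degree
    falling factorials are scaled delta functions on the simplex. *)
Lemma simplex_ffact_eq {k r} (d e : {ffun 'I_r.+1 -> 'I_(k - r).+1}) :
  d \in simplex k r -> e \in simplex k r ->
  (0 < \prod_i (d i) ^_ (e i))%N -> e = d.
Proof.
move=> dS eS /prod_ffact_gt0 le; apply/ffunP => i; apply: val_inj.
by apply: (sum_leq_eq _ _ _ le); rewrite !simplex_sum.
Qed.

Lemma prod_ffactnn_gt0 (I : finType) (d : I -> nat) :
  (0 < \prod_i (d i) ^_ (d i))%N.
Proof. by rewrite prodn_gt0 // => i; rewrite ffact_gt0. Qed.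

(** f_d is nonzero at the word of d, hence at the word of e when the two words coincide; such a
    value can only occur at d itself. *)
Lemma simplex_word_inj {k r} (d e : {ffun 'I_r.+1 -> 'I_(k - r).+1}) :
  d \in simplex k r -> e \in simplex k r ->
  simplex_word d = simplex_word e -> d = e.
Proof.
move=> dS eS de; apply: (simplex_ffact_eq e d) => //.
by rewrite -block_ffact_simplex -de block_ffact_simplex prod_ffactnn_gt0.
Qed.

Lemma word_count1 {k r} (w : word k r) : count_mem false (rawword w) = (k - r)%N.
Proof. by case: w => t wt; case/andP: (wt) => /eqP. Qed.

Lemma word_count2 {k r} (w : word k r) : count_mem true (rawword w) = r.
Proof. by case: w => t wt; case/andP: (wt) => _ /eqP. Qed.

Lemma size_word {k r} (w : word k r) : size (rawword w) = k.
Proof. exact: size_tuple. Qed.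

Lemma rawword_inj {k r} : injective (@rawword k r).
Proof. by move=> u v /val_inj /val_inj. Qed.

Lemma blocks_exist (s : seq bool) : exists c l, size l = count_mem true s /\
  s = nseq c false ++ flatten [seq true :: nseq i false | i <- l].
Proof.
elim: s => [|[] s [c [l [sl es]]]]; first by exists 0%N, [::].
  by exists 0%N, (c :: l); rewrite /= sl -es.
by exists c.+1, l; rewrite /= add0n -es.
Qed.

Lemma word_simplex {k r} (w : word k r) :
  exists2 d, d \in simplex k r & rawword w = simplex_word d.
Proof.
have [c [l [sl ew]]] := blocks_exist (rawword w).
rewrite word_count2 in sl.
have sumE : (c + sumn l)%N = (k - r)%N.
  rewrite -(word_count1 w) ew count_cat count_nseq mul1n count_flatten -map_comp.
  congr (c + sumn _)%N; rewrite -[LHS]map_id; apply: eq_map => i /=.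
  by rewrite count_nseq mul1n.
pose d := [ffun i : 'I_r.+1 => inord (nth 0%N (c :: l) i) : 'I_(k - r).+1].
(* Each block length is at most the total k - r, so [inord] never falls back to its default. *)
have dE i : d i = nth 0%N (c :: l) i :> nat.
  rewrite ffunE inordK // ltnS -sumE -[(c + _)%N]/(sumn (c :: l)) sumnE.
  have il : (i < size (c :: l))%N by rewrite /= sl.
  by rewrite (big_nth 0%N) big_mkord (bigD1 (Ordinal il)) //= leq_addr.
have lE : l = [seq (d (lift ord0 i) : nat) | i <- enum 'I_r].
  apply: (@eq_from_nth _ 0) => [|i]; first by rewrite size_map size_enum_ord.
  rewrite sl => il.
  by rewrite (nth_map (Ordinal il)) ?size_enum_ord // dE /= nth_enum_ord.
exists d.
  rewrite inE big_ord_recl; apply/eqP/(etrans _ sumE).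
  rewrite dE lE sumnE big_map big_enum /=.
  by congr addn; apply: eq_bigr => i _; rewrite -lE.
rewrite ew /simplex_word dE /=; congr (_ ++ flatten _).
by rewrite {1}lE -map_comp.
Qed.
End Words.

(** * The inner product on V_kr *)

Section Dot.
Context {R : realType}.

Lemma dotVC {k r} (u v : Vspace R k r) : dotV u v = dotV v u.
Proof. by apply: eq_bigr => w _; rewrite mulrC. Qed.

Lemma dotVDl {k r} (u v x : Vspace R k r) :
  dotV (u + v) x = dotV u x + dotV v x.
Proof. by rewrite -big_split /=; apply: eq_bigr => w _; rewrite ffunE mulrDl. Qed.

Lemma dotVZl {k r} (c : R) (u x : Vspace R k r) :
  dotV (c *: u) x = c * dotV u x.
Proof. by rewrite big_distrr /=; apply: eq_bigr => w _; rewrite ffunE mulrA. Qed.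

Lemma dotV0l {k r} (x : Vspace R k r) : dotV 0 x = 0.
Proof. by rewrite -(scale0r 0) dotVZl mul0r. Qed.

Lemma dotVNl {k r} (u x : Vspace R k r) : dotV (- u) x = - dotV u x.
Proof. by rewrite -scaleN1r dotVZl mulN1r. Qed.

Lemma dotVBl {k r} (u v x : Vspace R k r) :
  dotV (u - v) x = dotV u x - dotV v x.
Proof. by rewrite dotVDl dotVNl. Qed.

Lemma dotV_suml {k r} I (l : seq I) (p : pred I) (f : I -> Vspace R k r) x :
  dotV (\sum_(i <- l | p i) f i) x = \sum_(i <- l | p i) dotV (f i) x.
Proof.
apply: (big_morph (fun u => dotV u x)) => [u v|]; [exact: dotVDl|exact: dotV0l].
Qed.

Lemma dotV_eq0 {k r} (u : Vspace R k r) : dotV u u = 0 -> u = 0.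
Proof.
move=> /eqP; rewrite psumr_eq0 => [/allP h|w _]; last exact: sqr_ge0.
apply/ffunP => w; rewrite ffunE; apply/eqP.
by have := h w (mem_index_enum w); rewrite mulf_eq0 orbb.
Qed.

Lemma dotV_wvec {k r} (w : word k r) (u : Vspace R k r) :
  dotV (wvec R k r (rawword w)) u = u w.
Proof.
rewrite /dotV (bigD1 w) //= ffunE eqxx mul1r big1 ?addr0 // => w' ww'.
by rewrite ffunE (inj_eq rawword_inj) (negPf ww') mul0r.
Qed.

(** * Deletion paired with the vectors f_a *)

Definition ffact_vec k r (a : 'I_r.+1 -> nat) : Vspace R k r :=
  [ffun w => (block_ffact 0 [seq a i | i <- enum 'I_r.+1] (rawword w))%:R].

(** By linearity this is a claim about each word, where it is [sum_block_ffact_del] with [t = 0],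
    which kills the boundary term. *)
Lemma dotV_del {k r} (v : Vspace R k r) (a : 'I_r.+1 -> nat) :
  dotV (del v) (ffact_vec k.-1 r a)
  = ((k - r)%:R - (\sum_i a i)%:R) * dotV v (ffact_vec k r a).
Proof.
rewrite dotV_suml big_distrr /=; apply: eq_bigr => w _.
rewrite dotVZl mulrCA; congr (v w * _); rewrite dotV_suml ffunE.
set A := [seq a i | i <- enum 'I_r.+1].
have sA : size A = (count_mem true (rawword w)).+1.
  by rewrite size_map size_enum_ord word_count2.
have := sum_block_ffact_del 0 A (rawword w) sA.
rewrite mul0n !add0n word_count1 size_word sumnE big_map big_enum /=.
move=> /(congr1 (fun n => n%:R : R)); rewrite natrD !natrM natr_sum => e.
rewrite mulrBl -e addrK; apply: eq_bigr => i /eqP wi.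
have [w' ew'] := del_word (ltn_ord i) wi.
by rewrite -ew' dotV_wvec ffunE.
Qed.

Lemma iter_predn k i : iter i predn k = (k - i)%N.
Proof. by elim: i => [|i IH] /=; rewrite ?subn0 // IH subnS. Qed.

(** The constant is the product of k - r - l - |a| over l < i; the hypothesis makes every factor
    positive. *)
Lemma dotV_del_iter {k r} (a : 'I_r.+1 -> nat) i :
  (\sum_s a s + i <= k - r)%N ->
  exists2 c : R, c != 0 & forall v : Vspace R k r,
    dotV (del_iter i v) (ffact_vec (iter i predn k) r a)
    = c * dotV v (ffact_vec k r a).
Proof.
elim: i => [|i IH] ai; first by exists 1 => [|v]; rewrite ?oner_neq0 ?mul1r.
have [|c c0 e] := IH; first by lia.
exists (((iter i predn k - r)%:R - (\sum_s a s)%:R) * c).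
  rewrite mulf_neq0 // subr_eq0 eqr_nat iter_predn; apply/eqP; lia.
by move=> v; rewrite /= dotV_del e mulrA.
Qed.

Lemma del_eq0 {k r} (v : Vspace R k r) : (k - r = 0)%N -> del v = 0.
Proof.
move=> kr; apply: big1 => w _; rewrite big1 ?scaler0 // => i /eqP wi.
have : (0 < count_mem false (rawword w))%N.
  by rewrite -has_count has_pred1 -wi mem_nth // size_word.
by rewrite word_count1 kr.
Qed.

(** Forwards, divide by the nonzero constant of [dotV_del_iter]. Backwards, words of the target have
    j - 1 letters 1, and the f_d of such a word's block vector d vanishes at all other words, so
    pairing with f_d reads off one coordinate. *)
Lemma ker_delP {k r} i j (v : Vspace R k r) :
  (i + j = (k - r).+1)%N ->
  del_iter i v = 0 <->
  forall a, (\sum_s a s < j)%N -> dotV v (ffact_vec k r a) = 0.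
Proof.
move=> ij; split=> [v0 a aj|h].
  have [|c c0 e] := @dotV_del_iter k r a i; first by lia.
  by have /eqP := e v; rewrite v0 dotV0l eq_sym mulf_eq0 (negPf c0) => /eqP.
case: j ij h => [|j] ij h.
  (* After k - r deletions no letter 1 is left, so one more gives 0 without any orthogonality. *)
  have -> : i = (k - r).+1 by lia.
  have e : (iter (k - r) predn k - r = 0)%N by rewrite iter_predn; lia.
  exact: del_eq0 e.
apply/ffunP => w; rewrite ffunE.
have [d dS ew] := word_simplex w.
have sd : (\sum_s d s)%N = j by rewrite simplex_sum // iter_predn; lia.
have [|c c0 e] := @dotV_del_iter k r (fun s => d s) i; first by lia.
have {e} := e v; rewrite h ?sd // mulr0 /dotV (bigD1 w) //= big1 => [|w' ww'].
  rewrite addr0 ffunE ew block_ffact_simplex => /eqP.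
  rewrite mulf_eq0 pnatr_eq0 => /orP[/eqP //|].
  by rewrite -leqn0 leqNgt prod_ffactnn_gt0.
have [d' dS' ew'] := word_simplex w'.
rewrite ffunE ew' block_ffact_simplex.
have [->|p] := posnP (\prod_i (d' i) ^_ (d i))%N; first by rewrite mulr0.
have dd : d = d' by apply: (simplex_ffact_eq d' d).
by move: ww'; rewrite (rawword_inj w' w) ?eqxx // ew' ew dd.
Qed.

(** * The map [Psi] as evaluation on the simplex *)

Lemma Psi_word {k r} (P : {mpoly R[r.+1]}) (w : word k r) d :
  d \in simplex k r -> rawword w = simplex_word d ->
  Psi R k r P w = evalD P d.
Proof.
move=> dS ew; rewrite sum_ffunE (bigD1 d) //= big1 => [|e /andP[eS ne]].
  by rewrite addr0 !ffunE ew eqxx; exact: mulr1.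
rewrite !ffunE ew; case: eqP => [/(simplex_word_inj d e dS eS) de|_].
  by rewrite de eqxx in ne.
exact: mulr0.
Qed.

Lemma dotV_Psi {k r} (P Q : {mpoly R[r.+1]}) : (r <= k)%N ->
  dotV (Psi R k r P) (Psi R k r Q) = dotP k P Q.
Proof.
move=> rk; rewrite dotV_suml; apply: eq_bigr => d dS; rewrite dotVZl.
have [w ew] := simplex_word_word rk dS.
by rewrite -ew dotV_wvec (Psi_word _ _ d).
Qed.

Lemma Psi_linear {k r} : linear (Psi R k r).
Proof.
move=> c P Q; rewrite scaler_sumr -big_split /=; apply: eq_bigr => d dS.
by rewrite /evalD mevalD mevalZ scalerDl scalerA.
Qed.

HB.instance Definition _ k r :=
  GRing.isLinear.Build R {mpoly R[r.+1]} (Vspace R k r) _ (Psi R k r)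
    Psi_linear.

(** * Polynomials of bounded degree in x_1, ..., x_r *)

(** The bound is strict, so index 0 gives the zero space and [Rm R r m] has index [m.+1]. *)
Definition polys_lt r j : set {mpoly R[r.+1]} :=
  [set P | (forall e, e \in msupp P -> e ord0 = 0%N) /\ (msize P <= j)%N]%classic.

Lemma polys_ltP r j (P : {mpoly R[r.+1]}) :
  polys_lt r j P <->
  forall e, e \in msupp P -> e ord0 = 0%N /\ (mdeg e < j)%N.
Proof.
split=> [[h0 hj] e eP|h].
  by split; [exact: h0|exact: leq_trans (msize_mdeg_lt eP) hj].
split=> [e /h[] //|]; rewrite msizeE.
by apply/bigmax_leqP_seq => e /h[].
Qed.

Lemma polys_ltW r i j : (i <= j)%N -> (polys_lt r i `<=` polys_lt r j)%classic.
Proof. by move=> ij P [h0 hi]; split=> //; exact: leq_trans hi ij. Qed.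

Lemma polys_lt0 r j : polys_lt r j 0.
Proof. by apply/polys_ltP => e; rewrite msupp0. Qed.

Lemma polys_ltD r j P Q :
  polys_lt r j P -> polys_lt r j Q -> polys_lt r j (P + Q).
Proof.
move=> /polys_ltP hP /polys_ltP hQ; apply/polys_ltP => e /msuppD_le.
by rewrite mem_cat => /orP[/hP|/hQ].
Qed.

Lemma polys_ltZ r j c P : polys_lt r j P -> polys_lt r j (c *: P).
Proof. by move=> /polys_ltP h; apply/polys_ltP => e /msuppZ_le /h. Qed.

Lemma polys_ltB r j P Q :
  polys_lt r j P -> polys_lt r j Q -> polys_lt r j (P - Q).
Proof. by rewrite -scaleN1r => hP hQ; apply: polys_ltD => //; exact: polys_ltZ. Qed.

Lemma polys_lt_sum r j I (l : seq I) (p : pred I) (F : I -> {mpoly R[r.+1]}) :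
  (forall i, p i -> polys_lt r j (F i)) ->
  polys_lt r j (\sum_(i <- l | p i) F i).
Proof. by move=> h; apply: big_ind => //; [exact: polys_lt0|exact: polys_ltD]. Qed.

Lemma polys_ltX r j (e : 'X_{1.. r.+1}) : e ord0 = 0%N -> (mdeg e < j)%N -> polys_lt r j 'X_[e].
Proof. by move=> e0 ej; apply/polys_ltP => e'; rewrite msuppX inE => /eqP ->. Qed.

Lemma polys_ltC r j c : polys_lt r j.+1 c%:MP.
Proof.
apply/polys_ltP => e; rewrite msuppC; case: eqP => // _.
by rewrite inE => /eqP ->; rewrite mnm0E mdeg0.
Qed.

Lemma polys_ltM r i j P Q :
  polys_lt r i.+1 P -> polys_lt r j.+1 Q -> polys_lt r (i + j).+1 (P * Q).
Proof.
move=> /polys_ltP hP /polys_ltP hQ; apply/polys_ltP => e /msuppM_le.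
move=> /allpairsP[[e1 e2] [/= /hP[a1 b1] /hQ[a2 b2] ->]].
by rewrite mnmDE a1 a2 mdegD; split=> //; lia.
Qed.

Lemma polys_lt_prod r I (l : seq I) (f : I -> nat) (F : I -> {mpoly R[r.+1]}) :
  (forall i, polys_lt r (f i).+1 (F i)) ->
  polys_lt r (\sum_(i <- l) f i).+1 (\prod_(i <- l) F i).
Proof.
move=> h; elim/big_rec2: _ => [|i n P _]; first exact: polys_ltC.
exact: polys_ltM.
Qed.

(* On the simplex the coordinate x_0 agrees with [(k - r) - x_1 - ... - x_r]. *)
Definition simplex_coord k r (s : 'I_r.+1) : {mpoly R[r.+1]} :=
  if s == ord0 then ((k - r)%:R)%:MP - \sum_(i < r) 'X_(lift ord0 i) else 'X_s.

Lemma polys_lt_simplex_coord k r s : polys_lt r 2 (simplex_coord k r s).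
Proof.
have XE (t : 'I_r.+1) : t != ord0 -> polys_lt r 2 'X_t.
  by move=> t0; apply: polys_ltX; rewrite ?mdeg1 // mnm1E (negPf t0).
rewrite /simplex_coord; case: eqP => [_|/eqP]; last exact: XE.
apply: polys_ltB; first exact: polys_ltC.
by apply: polys_lt_sum => i _; exact: XE.
Qed.

Lemma evalD_simplex_coord {k r} (d : {ffun 'I_r.+1 -> 'I_(k - r).+1}) s :
  d \in simplex k r -> evalD (simplex_coord k r s) d = (d s)%:R.
Proof.
move=> dS; rewrite /evalD /simplex_coord; case: eqP => [->|_]; last by rewrite mevalXU.
have := congr1 (fun n => n%:R : R) (simplex_sum d dS).
rewrite big_ord_recl natrD natr_sum mevalB mevalC => <-.
rewrite (raddf_sum (meval _)) /=.
by under [X in _ - X]eq_bigr do rewrite mevalXU; rewrite addrK.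
Qed.

(** A polynomial free of x_0 that takes the values of f_a on the simplex. *)
Definition ffact_poly k r (a : 'I_r.+1 -> nat) : {mpoly R[r.+1]} :=
  \prod_s \prod_(i < a s) (simplex_coord k r s - (i%:R)%:MP).

Lemma polys_lt_ffact k r a : polys_lt r (\sum_s a s).+1 (ffact_poly k r a).
Proof.
apply: polys_lt_prod => s; rewrite -[X in X.+1](card_ord (a s)) -sum1_card.
apply: polys_lt_prod => i; apply: polys_ltB; first exact: polys_lt_simplex_coord.
exact: polys_ltC.
Qed.

Lemma natr_ffact n m : (n ^_ m)%:R = \prod_(i < m) (n%:R - i%:R) :> R.
Proof.
elim: m => [|m IH]; first by rewrite big_ord0.
rewrite ffactnSr natrM IH big_ord_recr /=; case: (leqP m n) => mn.
  by rewrite natrB.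
by rewrite -IH ffact_small // !mul0r.
Qed.

Lemma evalD_ffact {k r} (d : {ffun 'I_r.+1 -> 'I_(k - r).+1}) a :
  d \in simplex k r ->
  evalD (ffact_poly k r a) d = (\prod_s (d s) ^_ (a s))%:R.
Proof.
move=> dS; rewrite /evalD rmorph_prod natr_prod; apply: eq_bigr => s _.
rewrite rmorph_prod natr_ffact; apply: eq_bigr => i _.
by rewrite /= mevalB mevalC; congr (_ - _); exact: evalD_simplex_coord.
Qed.

Lemma Psi_ffact {k r} a : Psi R k r (ffact_poly k r a) = ffact_vec k r a.
Proof.
apply/ffunP => w; have [d dS ew] := word_simplex w.
by rewrite (Psi_word _ _ d) // evalD_ffact // ffunE ew block_ffact_simplex.
Qed.

(** * Orthogonality to the f_a versus orthogonality to polynomials *)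

Lemma evalDM {k r} (P Q : {mpoly R[r.+1]}) (d : {ffun 'I_r.+1 -> 'I_(k - r).+1}) :
  evalD (P * Q) d = evalD P d * evalD Q d.
Proof. exact: mevalM. Qed.

(* Lowers the degree of the monomial by [x * x^_n = x^_(n+1) + n * x^_n]. *)
Lemma dot_monom_ffact {k r} j (v : Vspace R k r) :
  (forall a, (\sum_s a s < j)%N -> dotV v (ffact_vec k r a) = 0) ->
  forall e a, (mdeg e + \sum_s a s < j)%N ->
  dotV v [ffun w => Psi R k r 'X_[e] w * ffact_vec k r a w] = 0.
Proof.
move=> h e; elim: {e}(mdeg e) {-2}e (erefl (mdeg e)) => [|n IH] e ne a ea.
  move/eqP: ne; rewrite mdeg_eq0 => /eqP e0.
  rewrite -[RHS](h a) ?(leq_ltn_trans _ ea) ?leq_addl //.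
  apply: eq_bigr => w _; rewrite ffunE; have [d dS ew] := word_simplex w.
  by rewrite (Psi_word _ _ d) // e0 mpolyX0 /evalD meval1 mul1r.
have [s es] : exists s, e s != 0%N.
  apply/existsP; apply: contra_eqT ne; rewrite negb_exists => /forallP e0.
  by rewrite mdegE big1 // => s _; apply/eqP; have := e0 s; rewrite negbK.
have eE : e = (U_(s) + (e - U_(s)))%MM by rewrite addmC submK // lep1mP.
set f := (e - U_(s))%MM in eE.
have fn : mdeg f = n by move: ne; rewrite eE mdegD mdeg1 add1n => -[].
pose b t := (a t + (t == s))%N.
have sb : (\sum_t b t = (\sum_t a t).+1)%N.
  rewrite big_split /= -[RHS]addn1; congr addn.
  by rewrite (bigD1 s) //= eqxx big1 // => t /negPf ->.
pose F c := [ffun w => Psi R k r 'X_[f] w * ffact_vec k r c w] : Vspace R k r.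
(* One factor x_s moves from the monomial into the falling factorial: mdeg f + |b| = mdeg e + |a|,
   so the induction covers both terms. *)
have : dotV v (F b + (a s)%:R *: F a) = 0.
  rewrite dotVC dotVDl dotVZl !(dotVC _ v) !IH ?mulr0 ?addr0 //; lia.
move=> <-; apply: eq_bigr => w _; congr (_ * _).
have [d dS ew] := word_simplex w.
rewrite !ffunE !(Psi_word _ w d) // eE mpolyXD evalDM {1}/evalD mevalXU.
rewrite ew !block_ffact_simplex.
have -> : (\prod_t d t ^_ b t = (\prod_t d t ^_ a t) * (d s - a s))%N.
  rewrite (bigD1 s) //= [in RHS](bigD1 s) //= /b eqxx addn1 ffactnSr.
  rewrite mulnAC; congr (_ * _ * _)%N.
  by apply: eq_bigr => t /negPf ->; rewrite addn0.
(* If a_s > d_s the natural subtraction truncates, but the falling factorial is already 0. *)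
have [le|gt] := leqP (a s) (d s).
  by rewrite natrM natrB // /GRing.scale /=; ring.
have -> : (\prod_t d t ^_ a t = 0)%N.
  by rewrite (bigD1 s) //= ffact_small // mul0n.
by rewrite mul0n /GRing.scale /=; ring.
Qed.

(** Forwards, expand in monomials and use [dot_monom_ffact] with a = 0, where f_0 is constantly 1.
    Backwards, f_a is the image of [ffact_poly]. *)
Lemma orth_polys_ltP {k r} j (v : Vspace R k r) :
  (forall a, (\sum_s a s < j)%N -> dotV v (ffact_vec k r a) = 0) <->
  forall P, polys_lt r j P -> dotV v (Psi R k r P) = 0.
Proof.
split=> [h P /polys_ltP hP|h a aj]; last first.
  by rewrite -Psi_ffact; apply: h; apply: polys_ltW aj _ (polys_lt_ffact k r a).
rewrite (mpolyE P) linear_sum dotVC dotV_suml big_seq big1 // => e /hP[_ ej].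
rewrite linearZ dotVZl dotVC.
have := dot_monom_ffact j v h e (fun=> 0%N); rewrite big1 // addn0 => /(_ ej) e0.
rewrite -[X in _ * X = _](_ : 0 = _) ?mulr0 // -[LHS]e0.
apply: eq_bigr => w _; rewrite !ffunE; have [d dS ew] := word_simplex w.
by rewrite ew block_ffact_simplex big1 // mulr1.
Qed.

(** * Interpolation on the simplex and injectivity of [Psi] *)

(** The sum k - r determines the erased coordinate, so simplex points index the monomials of degree
    at most k - r in x_1, ..., x_r. *)
Definition simplex_mnm {k r} (d : {ffun 'I_r.+1 -> 'I_(k - r).+1}) :
  'X_{1..r.+1} := [multinom if s == ord0 then 0%N else d s | s < r.+1].

Lemma simplex_mnm_inj {k r} (d e : {ffun 'I_r.+1 -> 'I_(k - r).+1}) :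
  d \in simplex k r -> e \in simplex k r ->
  simplex_mnm d = simplex_mnm e -> d = e.
Proof.
move=> dS eS /mnmP de.
have de' (i : 'I_r) : d (lift ord0 i) = e (lift ord0 i) :> nat.
  by have := de (lift ord0 i); rewrite !mnmE.
have := etrans (simplex_sum d dS) (esym (simplex_sum e eS)).
rewrite !big_ord_recl.
rewrite (eq_bigr _ (fun i _ => de' i)) => /addIn d0.
apply/ffunP => s; apply: val_inj.
by have [j ->|->] := unliftP ord0 s; [exact: de'|exact: d0].
Qed.

Lemma simplex_mnm_ex {k r} (m : 'X_{1..r.+1}) :
  m ord0 = 0%N -> (mdeg m <= k - r)%N ->
  exists2 d, d \in simplex k r & simplex_mnm d = m.
Proof.
move=> m0 mk.
have mE : mdeg m = (\sum_(i < r) m (lift ord0 i))%N.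
  by rewrite mdegE big_ord_recl m0.
pose d := [ffun s : 'I_r.+1 =>
  inord (if s == ord0 then (k - r - mdeg m)%N else m s) : 'I_(k - r).+1].
have d0 : d ord0 = (k - r - mdeg m)%N :> nat.
  by rewrite ffunE eqxx inordK // ltnS leq_subr.
have dE s : s != ord0 -> d s = m s :> nat.
  move=> /negPf s0; rewrite ffunE s0 inordK // ltnS (leq_trans _ mk) //.
  by rewrite mdegE (bigD1 s) //= leq_addr.
exists d.
  rewrite inE big_ord_recl d0; apply/eqP/(etrans _ (subnK mk)).
  by congr addn; rewrite mE; apply: eq_bigr => i _; rewrite dE.
by apply/mnmP => s; rewrite mnmE; case: eqP => [->|/eqP /dE].
Qed.

Lemma mpoly_simplexE {k r} (P : {mpoly R[r.+1]}) :
  polys_lt r (k - r).+1 P ->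
  P = \sum_(e in simplex k r) P@_(simplex_mnm e) *: 'X_[simplex_mnm e].
Proof.
move=> /polys_ltP hP; apply/mpolyP => m; rewrite (raddf_sum (mcoeff m)) /=.
have [mP|mP] := boolP (m \in msupp P).
  have [m0 mk] := hP m mP.
  have [e eS <-] := simplex_mnm_ex m m0 mk.
  rewrite (bigD1 e) //= big1 => [|f /andP[fS fe]].
    by rewrite addr0 mcoeffZ mcoeffX eqxx mulr1.
  rewrite mcoeffZ mcoeffX; case: eqP => [ef|_]; last by rewrite mulr0.
  by rewrite (simplex_mnm_inj _ _ fS eS ef) eqxx in fe.
rewrite (memN_msupp_eq0 mP) big1 // => e _; rewrite mcoeffZ mcoeffX.
by case: eqP => [->|_]; rewrite ?(memN_msupp_eq0 mP) ?mul0r ?mulr0.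
Qed.

Lemma evalD_simplexE {k r} (P : {mpoly R[r.+1]})
    (d : {ffun 'I_r.+1 -> 'I_(k - r).+1}) :
  polys_lt r (k - r).+1 P ->
  evalD P d = \sum_(e in simplex k r)
    evalD 'X_[simplex_mnm e] d * P@_(simplex_mnm e).
Proof.
move=> hP; rewrite {1}(mpoly_simplexE P hP) /evalD (raddf_sum (meval _)) /=.
by apply: eq_bigr => e _; rewrite mevalZ mulrC.
Qed.

(* The square matrix [(d, e) |-> d ^ e] is invertible: every delta function on
   the simplex is, up to a scalar, the value of a polynomial [ffact_poly]. *)
Lemma Psi_inj {k r} (P : {mpoly R[r.+1]}) :
  (r <= k)%N -> polys_lt r (k - r).+1 P -> Psi R k r P = 0 -> P = 0.
Proof.
move=> rk hP P0.
pose D (i : 'I_#|simplex k r|) := enum_val i.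
have DS i : D i \in simplex k r by exact: enum_valP.
have sumE (F : _ -> R) : \sum_(e in simplex k r) F e = \sum_i F (D i).
  exact: big_enum_val.
pose p i : {mpoly R[r.+1]} :=
  (\prod_s (D i s) ^_ (D i s))%:R^-1 *: ffact_poly k r (fun s => D i s).
have pP i : polys_lt r (k - r).+1 (p i).
  have := polys_lt_ffact k r (fun s => D i s).
  by rewrite simplex_sum //; exact: polys_ltZ.
have pE i j : evalD (p i) (D j) = (j == i)%:R.
  rewrite /evalD mevalZ [X in _ * X](evalD_ffact (D j)) //.
  have [->|ji] := eqVneq j i.
    by rewrite mulVf // pnatr_eq0 -lt0n prod_ffactnn_gt0.
  have [->|/(simplex_ffact_eq _ _ (DS j) (DS i)) /enum_val_inj e] :=
    posnP (\prod_s (D j s) ^_ (D i s))%N; first by rewrite mulr0.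
  by rewrite e eqxx in ji.
pose M := \matrix_(i, l) evalD ('X_[simplex_mnm (D l)] : {mpoly R[r.+1]}) (D i).
pose C := \matrix_(l, j) (p j)@_(simplex_mnm (D l)).
(* [C] holds the coefficients of the delta polynomials [p j]. Since both matrices are square, this
   right inverse of [M] is also a left inverse. *)
have MC : M *m C = 1%:M.
  apply/matrixP => i j; rewrite !mxE -pE evalD_simplexE // sumE.
  by apply: eq_bigr => l _; rewrite !mxE.
pose c := \col_l P@_(simplex_mnm (D l)).
have Mc : M *m c = 0.
  apply/matrixP => i j; rewrite !mxE.
  have [w ew] := simplex_word_word rk (DS i).
  have := congr1 (fun u : Vspace R k r => u w) P0.
  rewrite (Psi_word P w (D i)) // ffunE evalD_simplexE // sumE => {2}<-.
  by apply: eq_bigr => l _; rewrite !mxE.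
have c0 : c = 0 by rewrite -[c]mul1mx -(mulmx1C MC) -mulmxA Mc mulmx0.
rewrite (mpoly_simplexE P hP) big_enum_val big1 // => l _.
by have /matrixP/(_ l 0) := c0; rewrite !mxE => ->; rewrite scale0r.
Qed.

(** * Orthogonal projection *)

(** A Gram-Schmidt step: besides projecting [v] on the span of [X], subtract its component along the
    residual [x - z] of the new vector. *)
Lemma orth_decomp {k r} (X : seq (Vspace R k r)) (v : Vspace R k r) :
  exists2 w, w \in <<X>>%VS & forall x, x \in X -> dotV (v - w) x = 0.
Proof.
elim: X v => [|x X IH] v; first by exists 0; rewrite ?mem0v.
have subX : {subset <<X>>%VS <= <<x :: X>>%VS}.
  by apply/subvP; apply: sub_span => y yX; rewrite inE yX orbT.
have [w wX vw] := IH v; have [z zX xz] := IH x.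
have span_orth (u : Vspace R k r) : (forall y, y \in X -> dotV u y = 0) ->
    forall y, y \in <<X>>%VS -> dotV u y = 0.
  move=> uX y /(coord_span (X := in_tuple X)) ->.
  rewrite dotVC dotV_suml big1 // => i _; rewrite dotVZl dotVC uX ?mulr0 //.
  exact: mem_nth.
pose t := dotV (v - w) (x - z) / dotV (x - z) (x - z).
exists (w + t *: (x - z)).
  have xS : x \in <<x :: X>>%VS by rewrite memv_span ?mem_head.
  exact: memvD (subX _ wX) (memvZ _ (memvB xS (subX _ zX))).
have tE : dotV (v - (w + t *: (x - z))) (x - z) = 0.
  rewrite opprD addrA dotVBl dotVZl /t.
  (* If the residual has norm 0 it is itself 0, so the division by zero in [t] is harmless. *)
  have [xz0|nz] := eqVneq (dotV (x - z) (x - z)) 0.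
    by rewrite (dotV_eq0 _ xz0) !(dotVC _ 0) !dotV0l mulr0 subr0.
  by rewrite divfK // subrr.
have orthX y : y \in X -> dotV (v - (w + t *: (x - z))) y = 0.
  by move=> yX; rewrite opprD addrA dotVBl dotVZl vw // xz // mulr0 subr0.
move=> y; rewrite inE => /predU1P[->|]; last exact: orthX.
rewrite -[x](subrK z) dotVC dotVDl !(dotVC _ (v - _)) subrK tE.
by rewrite (span_orth _ orthX) ?addr0.
Qed.

Lemma Psi_decomp {k r} j (v : Vspace R k r) :
  exists2 P, polys_lt r j P &
    forall Q, polys_lt r j Q -> dotV (v - Psi R k r P) (Psi R k r Q) = 0.
Proof.
(* The finitely many monomials of degree below [j] without x_0; their images span the space to
   project on. *)
pose E := [seq bmnm e | e <- enum {: 'X_{1..r.+1 < j}} & bmnm e ord0 == 0%N].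
have EP e : e \in E -> polys_lt r j 'X_[e].
  move=> /mapP[b]; rewrite mem_filter => /andP[/eqP b0 _] ->.
  by apply: polys_ltX => //; exact: bmdeg.
have [w wX vw] := orth_decomp [seq Psi R k r 'X_[e] | e <- E] v.
have [P hP wE] : exists2 P, polys_lt r j P & w = Psi R k r P.
  rewrite (coord_span (X := in_tuple _) wX).
  set T := in_tuple _.
  have h i : exists2 P, polys_lt r j P & T`_i = Psi R k r P.
    have [iT|iT] := ltnP i (size T); last first.
      by exists 0; [exact: polys_lt0|rewrite linear0 nth_default].
    by have /mapP[e /EP eE ->] := mem_nth 0 iT; exists 'X_[e].
  apply: (big_ind (fun u => exists2 P, polys_lt r j P & u = Psi R k r P)).
  - by exists 0; [exact: polys_lt0|rewrite linear0].
  - move=> _ _ [P hP ->] [Q hQ ->].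
    by exists (P + Q); [exact: polys_ltD|rewrite linearD].
  - move=> i _; have [P hP ->] := h i.
    by exists (coord T i w *: P); [exact: polys_ltZ|rewrite linearZ].
exists P => // Q /polys_ltP hQ; rewrite -wE (mpolyE Q) linear_sum dotVC dotV_suml.
rewrite big_seq big1 // => e /hQ[e0 ej]; rewrite linearZ dotVZl dotVC vw ?mulr0 //.
apply: map_f; apply/mapP; exists (BMultinom ej) => //.
by rewrite mem_filter /= e0 eqxx mem_enum.
Qed.

(** * U_krm and V_krm as orthogonal complements *)

(** The spaces U_krj with j < m together span all polynomials of degree below m, by successive
    orthogonal projections. *)
Lemma UkrmP {k r} m (P : {mpoly R[r.+1]}) : (r <= k)%N ->
  Ukrm R k r m P <->
  polys_lt r m.+1 P /\
  forall Q, polys_lt r m Q -> dotV (Psi R k r P) (Psi R k r Q) = 0.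
Proof.
move=> rk; split=> -[hP PQ]; split=> // Q; last first.
  move=> /UbelowP[j jm [hQ _]]; rewrite -dotV_Psi //.
  exact: PQ (polys_ltW _ _ _ jm _ hQ).
have [n] := ubnP m; move: (leqnn m).
suff H j : (j <= m)%N -> polys_lt r j Q ->
    dotV (Psi R k r P) (Psi R k r Q) = 0 by move=> _ _; exact: H.
elim: j Q => [|j IH] Q jm hQ.
  case: hQ => _; rewrite leqn0 msize_poly_eq0 => /eqP ->.
  by rewrite linear0 dotVC dotV0l.
(* [Q - S] has degree at most j and is orthogonal to all lower degrees, so it lies in U_krj; [S] is
   left to the induction. *)
have [S hS QS] := Psi_decomp j (Psi R k r Q).
rewrite -[Q](subrK S) linearD dotVC dotVDl !(dotVC _ (Psi R k r P)).
rewrite (IH S) ?(ltnW jm) // addr0 dotV_Psi //.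
apply: PQ; apply/UbelowP; exists j => //; split.
  by apply: polys_ltB => //; exact: polys_ltW (leqnSn j) _ hS.
move=> T /UbelowP[i ij [hT _]]; rewrite -dotV_Psi // linearB.
exact: QS (polys_ltW _ _ _ ij _ hT).
Qed.

Lemma VkrmP {k r} m (v : Vspace R k r) : (m <= k - r)%N ->
  Vkrm R k r m v <->
  (exists2 P, polys_lt r m.+1 P & v = Psi R k r P) /\
  forall Q, polys_lt r m Q -> dotV v (Psi R k r Q) = 0.
Proof.
move=> mk.
have kerP i j u : (i + j = (k - r).+1)%N -> ker_del R k r i u <->
    forall Q, polys_lt r j Q -> dotV u (Psi R k r Q) = 0.
  by move=> ij; apply: (iff_trans (ker_delP i j u ij)); exact: orth_polys_ltP.
(* The exponents k - r - m + 1 and k - r - m correspond to the degree bounds [m] and [m.+1]. *)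
have ker1 u := kerP (k - r - m + 1)%N m u ltac:(lia).
have ker2 u := kerP (k - r - m)%N m.+1 u ltac:(lia).
split=> [[/ker1 v1 v2]|[[P hP vP] vQ]]; split=> //; last 2 first.
- exact/ker1.
- by move=> u /ker2 uP; rewrite vP uP.
(* The residual [v - Psi R k r P] lies in the smaller kernel, so it is orthogonal to [v] as well as
   to [Psi R k r P], hence to itself. *)
have [P hP vP] := Psi_decomp m.+1 v; exists P => //.
apply/eqP; rewrite -subr_eq0; apply/eqP/dotV_eq0.
have /ker2 k2 := vP; by rewrite dotVBl dotVC (v2 _ k2) dotVC vP // subr0.
Qed.

End Dot.

Theorem theorem2p13 (R : realType) (k r m : nat)
    (hrk : (r <= k)%N) (hm : (m <= k - r)%N) :
  linear (Psi R k r) /\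
  set_bij (Ukrm R k r m) (Vkrm R k r m) (Psi R k r).
Proof.
split; first exact: Psi_linear.
split=> [P /(UkrmP _ _ hrk)[hP PQ]|P Q|v /(VkrmP _ _ hm)[[P hP ->] PQ]].
- by apply/VkrmP => //; split=> //; exists P.
(* The difference has degree at most m <= k - r, where [Psi] is injective. *)
- rewrite !inE => /(UkrmP _ _ hrk)[hP _] /(UkrmP _ _ hrk)[hQ _] PQ.
  apply/eqP; rewrite -subr_eq0; apply/eqP/(Psi_inj _ hrk).
    by apply: polys_ltW (polys_ltB _ _ _ _ hP hQ).
  by rewrite linearB /= PQ subrr.
- by exists P => //; apply/UkrmP.
Qed.
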